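(* Let $Q=2^m$, let $a,b\in\mathbb F_Q$, and let $\ell,m$ be distinct non-tangent lines with $\hat\rho(\ell,m)=0$. Let $N$ be the number of non-tangent lines $n$ with $\hat\rho(\ell,n)=a$ and $\hat\rho(n,m)=b$. - If $\ell\in\mathcal L_{-1}$, then $N=0$. - If $\ell\in\mathcal L_1$, then $N=Q+1$ if $a=b=0$; $N=1$ if $a=b\ne0$; and $N=2$ if $a+b\in T_0^*$.
   Context: Let $Q=2^m$ and work in $\mathrm{PG}(2,Q)$. Conic and lines. - Points are nonzero vectors up to scalars, and $(a,b,c)^\perp$ denotes the line $aX+bY+cZ=0$. - The conic is $\mathcal O=\{(\xi,\xi^2,1)^\top:\xi\in\mathbb F_Q\}\cup\{(0,1,0)^\top\}$. - The non-tangent lines (meeting $\mathcal O$ in $0$ or $2$ points) are exactly the lines $(1,x,y)^\perp$, $x,y\in\mathbb F_Q$. - Such a line lies in $\mathcal L_1$ (secant) if $\mathrm{Tr}(xy)=0$ and in $\mathcal L_{-1}$ (exterior) if $\mathrm{Tr}(xy)=1$, where $\mathrm{Tr}$ is the absolute trace $\mathbb F_Q\to\mathbb F_2$. Modified cross-ratio. - For $\ell=(1,x,y)^\perp$ and $n=(1,z,u)^\perp$: $\hat\rho(\ell,n)=x^2u^2+y^2z^2+(x+z)(y+u)$. Other notation. - $T_0=\{x\in\mathbb F_Q:\mathrm{Tr}(x)=0\}$ and $T_0^*=T_0\setminus\{0\}$. *)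

(* Defs.v *)
From HB Require Import structures.
From mathcomp Require Import all_boot all_order all_algebra.
From mathcomp Require Import all_fingroup all_solvable all_field.
From mathcomp Require Import ring.

Set Implicit Arguments.
Unset Strict Implicit.
Unset Printing Implicit Defensive.

Import GRing.Theory.
Local Open Scope ring_scope.

(* The absolute trace. Its values, a priori in F, lie in the prime field:
   for F of order a power of 2 they are 0 and 1 (see [abs_trace_01]). *)
Definition abs_trace (F : finFieldType) (x : F) : F :=
  let p := pdiv #|F| in \sum_(i < logn p #|F|) x ^+ (p ^ i).

Definition T0 (F : finFieldType) : {set F} := [set x | abs_trace x == 0].
Definition T0star (F : finFieldType) : {set F} := T0 F :\ 0.

Section ProjectivePlane.
Variable F : finFieldType.

Definition row3 (a b c : F) : 'rV[F]_3 := \row_j [:: a; b; c]`_j.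
Definition col3 (a b c : F) : 'cV[F]_3 := \col_i [:: a; b; c]`_i.

(* A point of PG(2,F) is a class of nonzero vectors up to nonzero scalars,
   and a line is a set of points. *)
Definition pt (v : 'cV[F]_3) : {set 'cV[F]_3} := [set c *: v | c : F & c != 0].

Definition perp (w : 'rV[F]_3) : {set {set 'cV[F]_3}} :=
  [set pt v | v : 'cV[F]_3 & (v != 0) && (w *m v == 0)].

Definition lines : {set {set {set 'cV[F]_3}}} :=
  [set perp w | w : 'rV[F]_3 & w != 0].

Definition conic : {set {set 'cV[F]_3}} :=
  pt (col3 0 1 0) |: [set pt (col3 xi (xi ^+ 2) 1) | xi : F].

(* L_1 *)
Definition secant_lines : {set {set {set 'cV[F]_3}}} :=
  [set l in lines | #|l :&: conic| == 2%N].

(* L_{-1} *)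
Definition exterior_lines : {set {set {set 'cV[F]_3}}} :=
  [set l in lines | #|l :&: conic| == 0%N].

Definition nontangent_lines : {set {set {set 'cV[F]_3}}} :=
  secant_lines :|: exterior_lines.

(* The pair (x, y) such that l = (1, x, y)^perp: see [nt_coordsK] and
   [nontangent_linesP]; (0, 0) is a junk value when there is no such pair. *)
Definition nt_coords (l : {set {set 'cV[F]_3}}) : F * F :=
  odflt (0, 0) [pick p : F * F | l == perp (row3 1 p.1 p.2)].

Definition rho_hat (l n : {set {set 'cV[F]_3}}) : F :=
  let: (x, y) := nt_coords l in
  let: (z, u) := nt_coords n in
  x ^+ 2 * u ^+ 2 + y ^+ 2 * z ^+ 2 + (x + z) * (y + u).

Lemma mul_row3_col3 (a b c x y z : F) :
  row3 a b c *m col3 x y z = (a * x + b * y + c * z)%:M.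
Proof.
apply/matrixP => i j; rewrite !ord1 !mxE !big_ord_recl big_ord0 !mxE /=.
by rewrite addr0 addrA.
Qed.

Lemma row3E (w : 'rV[F]_3) : exists a b c, w = row3 a b c.
Proof.
exists (w ord0 (inord 0)), (w ord0 (inord 1)), (w ord0 (inord 2)).
apply/rowP => j; rewrite !mxE.
by case: j => [[|[|[|j]]] jP] //=; congr (w _ _); apply/val_inj; rewrite /= inordK.
Qed.

Lemma col3_eq0 (x y z : F) : (col3 x y z == 0) = [&& x == 0, y == 0 & z == 0].
Proof.
apply/eqP/and3P => [/matrixP h | [/eqP-> /eqP-> /eqP->]].
  have h0 := h ord0 ord0; have h1 := h (inord 1) ord0; have h2 := h (inord 2) ord0.
  by move: h0 h1 h2; rewrite !mxE !inordK //= => -> -> ->.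
by apply/matrixP => i j; rewrite !mxE; case: i => [[|[|[|i]]] iP].
Qed.

Lemma row3_eq0 (x y z : F) : (row3 x y z == 0) = [&& x == 0, y == 0 & z == 0].
Proof.
rewrite -col3_eq0; apply/eqP/eqP => /matrixP h; apply/matrixP => i j.
  by have := h j i; rewrite !mxE.
by have := h j i; rewrite !mxE.
Qed.

Lemma pt_eqP (v w : 'cV[F]_3) :
  reflect (exists2 c, c != 0 & v = c *: w) (pt v == pt w).
Proof.
apply: (iffP eqP) => [e | [c c0 ->]].
  have : v \in pt v by apply/imsetP; exists 1; rewrite ?inE ?oner_neq0 ?scale1r.
  by rewrite e => /imsetP [c]; rewrite inE => c0 ->; exists c.
apply/setP => t; apply/imsetP/imsetP => [] [d]; rewrite inE => d0 ->.
  by exists (d * c); rewrite ?inE ?mulf_neq0 ?scalerA.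
exists (d / c); first by rewrite inE mulf_neq0 ?invr_eq0.
by rewrite scalerA divfK.
Qed.

Lemma mem_perp (w : 'rV[F]_3) (v : 'cV[F]_3) :
  v != 0 -> (pt v \in perp w) = (w *m v == 0).
Proof.
move=> v0; apply/imsetP/idP => [[t] | h]; last by exists v; rewrite ?inE ?v0.
rewrite inE => /andP [_ /eqP tw] /eqP/pt_eqP [c _ ->].
by rewrite -scalemxAr tw scaler0.
Qed.

Lemma mem_perp_row3 (a b c x y z : F) :
  col3 x y z != 0 ->
  (pt (col3 x y z) \in perp (row3 a b c)) = (a * x + b * y + c * z == 0).
Proof.
move=> v0; rewrite mem_perp // mul_row3_col3.
apply/eqP/eqP => [/matrixP/(_ ord0 ord0)|->]; first by rewrite !mxE eqxx.
by rewrite raddf0.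
Qed.

Lemma perp_scale (c : F) (w : 'rV[F]_3) : c != 0 -> perp (c *: w) = perp w.
Proof.
move=> c0; apply/setP => P; apply/imsetP/imsetP => [] [v vP ->]; exists v => //; move: vP;
  by rewrite !inE -scalemxAl scaler_eq0 (negPf c0).
Qed.

Lemma perp_row3_inj (x y z u : F) :
  perp (row3 1 x y) = perp (row3 1 z u) -> (x, y) = (z, u).
Proof.
move=> e.
have n1 : col3 (- x) 1 0 != 0 by rewrite col3_eq0 oner_eq0 andbF.
have n2 : col3 (- y) 0 1 != 0 by rewrite col3_eq0 oner_eq0 !andbF.
have : pt (col3 (- x) 1 0) \in perp (row3 1 z u).
  by rewrite -e mem_perp_row3 // mulr0 mul1r mulr1 addr0 addNr.
have : pt (col3 (- y) 0 1) \in perp (row3 1 z u).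
  by rewrite -e mem_perp_row3 // mulr0 mul1r mulr1 addr0 addNr.
rewrite !mem_perp_row3 // !mulr0 !mul1r !mulr1 !addr0 ![- _ + _]addrC !subr_eq0.
by move=> /eqP-> /eqP->.
Qed.

Lemma nt_coordsK (x y : F) : nt_coords (perp (row3 1 x y)) = (x, y).
Proof.
rewrite /nt_coords; case: pickP => [[z u] /eqP /perp_row3_inj -> //|].
by move=> /(_ (x, y)); rewrite eqxx.
Qed.

Lemma mem_lines (x y : F) : perp (row3 1 x y) \in lines.
Proof. by apply/imsetP; exists (row3 1 x y); rewrite ?inE ?row3_eq0 ?oner_eq0. Qed.

Definition conic_vec (o : option F) : 'cV[F]_3 :=
  if o is Some xi then col3 xi (xi ^+ 2) 1 else col3 0 1 0.

Lemma conic_vec_neq0 (o : option F) : conic_vec o != 0.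
Proof. by case: o => [xi|]; rewrite col3_eq0 oner_eq0 ?andbF. Qed.

Lemma conic_vec_inj : injective (pt \o conic_vec).
Proof.
have E (v w : 'cV[F]_3) c i : v = c *: w -> v i ord0 = c * w i ord0.
  by move=> ->; rewrite mxE.
move=> [s|] [t|] //= /eqP/pt_eqP [c c0] e.
- have := E _ _ _ (inord 2) e; have := E _ _ _ (inord 0) e.
  by rewrite !mxE !inordK //= mulr1 => -> <-; rewrite mul1r.
- have := E _ _ _ (inord 2) e.
  by rewrite !mxE !inordK //= mulr0 => /eqP; rewrite oner_eq0.
have := E _ _ _ (inord 2) e.
by rewrite !mxE !inordK //= mulr1 => /esym/eqP; rewrite (negPf c0).
Qed.

Lemma card_perp_conic (w : 'rV[F]_3) :
  #|perp w :&: conic| = #|[set o | w *m conic_vec o == 0]|.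
Proof.
rewrite -(card_imset _ conic_vec_inj); apply: eq_card => P; rewrite inE.
apply/andP/imsetP => [[Pl] | [o]]; last first.
  rewrite inE => h ->; rewrite /= mem_perp ?conic_vec_neq0 //; split => //.
  case: o h => [xi|] _; rewrite in_setU1; apply/orP; last by left.
  by right; apply/imsetP; exists xi.
rewrite in_setU1 => /orP [/eqP e | /imsetP [xi _ e]].
  by exists None; rewrite // inE -mem_perp ?conic_vec_neq0 // -e.
by exists (Some xi); rewrite // inE -mem_perp ?conic_vec_neq0 // -e.
Qed.

Lemma card_perp_row3_conic (a b c : F) :
  #|perp (row3 a b c) :&: conic| =
  addn (b == 0) #|[set xi : F | a * xi + b * xi ^+ 2 + c == 0]|.
Proof.
have S0 (s : F) : (s%:M == 0 :> 'M_1) = (s == 0).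
  apply/eqP/eqP => [/matrixP/(_ ord0 ord0)|->]; first by rewrite !mxE eqxx.
  by rewrite raddf0.
have SI : injective (@Some F) by move=> s t [].
rewrite card_perp_conic (cardsD1 None); congr (_ + _)%N.
  by rewrite inE /= mul_row3_col3 S0 !mulr0 mulr1 add0r addr0.
rewrite -(card_imset _ SI); apply: eq_card => [[xi|]].
  rewrite (mem_imset _ _ SI) !inE /= mul_row3_col3 S0.
  by rewrite mulr1.
rewrite !inE /=; apply/esym/negbTE/negP.
by case/imsetP.
Qed.

End ProjectivePlane.

Section EvenOrder.
Variables (F : finFieldType) (k : nat).
Hypothesis Fk : #|F| = (2 ^ k)%N.

Let k_gt0 : (0 < k)%N.
Proof. by case: k Fk (finNzRing_gt1 F) => // ->. Qed.

Lemma abs_trace2E (x : F) : abs_trace x = \sum_(i < k) x ^+ (2 ^ i).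
Proof.
have p2 : pdiv #|F| = 2 by rewrite Fk -(prednK k_gt0) pdiv_pfactor.
by rewrite /abs_trace p2 Fk pfactorK.
Qed.

Let ch2 : 2 \in [pchar F].
Proof.
rewrite inE /=; have : 1 *+ #|F| = 0 :> F.
  by have := expg_cardG (in_setT (1 : F)); rewrite cardsT FinRing.zmodXgE.
by rewrite Fk natrX => /eqP; rewrite expf_eq0 => /andP [].
Qed.

Let addxx (x : F) : x + x = 0.
Proof. by rewrite addrr_pchar2. Qed.

Let oppx (x : F) : - x = x.
Proof. by rewrite oppr_pchar2. Qed.

Let sqrD (x y : F) : (x + y) ^+ 2 = x ^+ 2 + y ^+ 2.
Proof. by rewrite sqrrD mulr2n addxx addr0. Qed.

Let sqr_inj : injective (fun x : F => x ^+ 2).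
Proof.
move=> x y /= e; apply/eqP; rewrite -subr_eq0 oppx.
have : (x + y) ^+ 2 == 0 by rewrite sqrD e addxx.
by rewrite expf_eq0.
Qed.

Lemma abs_traceD (x y : F) : abs_trace (x + y) = abs_trace x + abs_trace y.
Proof.
rewrite !abs_trace2E -big_split; apply: eq_bigr => i _ /=.
by elim: (nat_of_ord i) => [|j IH]; rewrite ?expr1 // expnSr !exprM IH sqrD.
Qed.

Lemma abs_trace_sqr (x : F) : abs_trace (x ^+ 2) = abs_trace x.
Proof.
rewrite !abs_trace2E; case: k Fk k_gt0 => // j Fj _.
rewrite big_ord_recr big_ord_recl /= addrC; congr (_ + _).
  by rewrite -exprM -expnS -Fj expf_card expr1.
by apply: eq_bigr => i _; rewrite /bump /= -exprM -expnS.
Qed.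

Lemma abs_trace_01 (x : F) : abs_trace x = 0 \/ abs_trace x = 1.
Proof.
have e : abs_trace x ^+ 2 = abs_trace x.
  rewrite -[RHS]abs_trace_sqr !abs_trace2E.
  have S n (f : nat -> F) : (\sum_(i < n) f i) ^+ 2 = \sum_(i < n) f i ^+ 2.
    by elim: n => [|n IH]; rewrite ?big_ord0 ?expr0n // !big_ord_recr sqrD IH.
  rewrite (S k (fun i => x ^+ (2 ^ i))); apply: eq_bigr => i _.
  by rewrite -!exprM mulnC.
have : abs_trace x * (abs_trace x - 1) == 0.
  by rewrite mulrBr mulr1 -expr2 e subrr.
by rewrite mulf_eq0 subr_eq0 => /orP [] /eqP; [left | right].
Qed.

(* Additive Hilbert 90: both sides have 2 ^ k.-1 elements. *)
Lemma abs_trace_eq0 (c : F) :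
  abs_trace c = 0 <-> exists t, t ^+ 2 + t + c = 0.
Proof.
split=> [|[t e]]; last first.
  have -> : c = t ^+ 2 + t.
    by apply/esym/eqP; rewrite -subr_eq0 oppx e.
  by rewrite abs_traceD abs_trace_sqr addxx.
pose f (t : F) := t ^+ 2 + t.
have fD t s : f (t + s) = f t + f s.
  by rewrite /f sqrD addrACA.
have f0 t : (f t == 0) = (t == 0) || (t == 1).
  by rewrite /f -[X in _ + X]mulr1 expr2 -mulrDr mulf_eq0 addr_eq0 oppx.
have sub : f @: F \subset T0 F.
  apply/subsetP => y /imsetP [t _ ->]; rewrite inE.
  by rewrite abs_traceD abs_trace_sqr addxx.
have im_ge : (2 ^ k.-1 <= #|f @: F|)%N.
  have : (#|F| <= 2 * #|f @: F|)%N.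
    rewrite mulnC -sum_nat_const -sum1_card (partition_big_imset f) /=.
    apply: leq_sum => y /imsetP [t _ ->].
    rewrite sum1dep_card; apply: (@leq_trans #|[set t; t + 1]|); last first.
      by rewrite cards2; case: (_ != _).
    apply: subset_leq_card; apply/subsetP => s; rewrite !inE /=.
    move=> e; have : f (s + t) == 0 by rewrite fD (eqP e) addxx.
    by rewrite f0 !addr_eq0 -!(addrC t) oppx; case/orP => /eqP e';
      rewrite ?e' ?eqxx // -[1]e' addrA addxx add0r eqxx orbT.
  by rewrite Fk -(prednK k_gt0) expnS leq_pmul2l.
have T_le : (#|T0 F| <= 2 ^ k.-1)%N.
  pose p : {poly F} := \sum_(i < k) 'X ^+ (2 ^ i).
  have sz n : size (\sum_(i < n.+1) 'X ^+ (2 ^ i) : {poly F}) = (2 ^ n).+1.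
    elim: n => [|n IH]; first by rewrite big_ord1 size_polyXn.
    rewrite big_ord_recr /= addrC size_polyDl ?size_polyXn // IH.
    by rewrite !ltnS ltn_exp2l.
  have szp : size p = (2 ^ k.-1).+1 by rewrite /p -(prednK k_gt0) sz.
  have p0 : p != 0 by rewrite -size_poly_eq0 szp.
  have := @max_poly_roots _ p (enum (T0 F)) p0.
  rewrite szp -cardE ltnS; apply; last exact: enum_uniq.
  apply/allP => x; rewrite mem_enum inE abs_trace2E /root /p horner_sum.
  by under [X in _ -> X == 0]eq_bigr => i _ do rewrite hornerXn.
have /eqP e : f @: F == T0 F by rewrite eqEcard sub (leq_trans T_le).
move=> c0; have : c \in T0 F by rewrite inE c0.
by rewrite -e => /imsetP [t _ ->]; exists t; rewrite addxx.
Qed.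

Let trace_neq1 (x : F) : (abs_trace x == 1) = (abs_trace x != 0).
Proof.
by case: (abs_trace_01 x) => ->; rewrite ?eqxx ?oner_eq0 // eq_sym oner_eq0.
Qed.

Lemma card_nontangent (x y : F) :
  #|perp (row3 1 x y) :&: conic F| = if abs_trace (x * y) == 0 then 2%N else 0%N.
Proof.
rewrite card_perp_row3_conic.
have [->|x0] := eqVneq x 0.
  have -> : abs_trace (0 * y) = 0.
    by apply/abs_trace_eq0; exists 0; rewrite mul0r expr0n /= !addr0.
  rewrite eqxx (_ : [set _ | _] = [set y]) ?cards1 //.
  by apply/setP => s; rewrite !inE mul1r mul0r addr0 addr_eq0 oppx.
rewrite add0n.
have E s : (1 * s + x * s ^+ 2 + y == 0) = ((x * s) ^+ 2 + x * s + x * y == 0).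
  rewrite -[RHS](inj_eq (mulfI (invr_neq0 x0))) mulr0.
  by congr (_ == 0); field.
case: ifPn => [/eqP/abs_trace_eq0 [t et]|nt].
  rewrite (_ : [set _ | _] = [set t / x; (t + 1) / x]).
    rewrite cards2 (inj_eq (mulIf (invr_neq0 x0))).
    by rewrite -subr_eq0 opprD addrA subrr add0r oppr_eq0 oner_eq0.
  apply/setP => s; rewrite !inE E.
  have D u : (s == u / x) = (x * s == u).
    by rewrite -(inj_eq (mulfI x0)) [x * (u / x)]mulrC divfK.
  rewrite !D; set r := x * s.
  have -> : x * y = - (t ^+ 2 + t) by apply/eqP; rewrite -addr_eq0 addrC et.
  rewrite -[r == t]subr_eq0 -[r == t + 1]subr_eq0 -mulf_eq0; congr (_ == 0).
  have -> : (r - t) * (r - (t + 1)) = r ^+ 2 - r + (t ^+ 2 + t) - (t * r + t * r).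
    by ring.
  by rewrite addxx !oppx addr0.
apply/eqP; rewrite cards_eq0; apply/eqP/setP => s; rewrite !inE E.
apply/negP => /eqP e; move/eqP: nt; apply; apply/abs_trace_eq0.
by exists (x * s).
Qed.

Lemma secant_perpE (x y : F) :
  (perp (row3 1 x y) \in secant_lines F) = (abs_trace (x * y) == 0).
Proof. by rewrite inE mem_lines card_nontangent; case: ifP. Qed.

Lemma exterior_perpE (x y : F) :
  (perp (row3 1 x y) \in exterior_lines F) = (abs_trace (x * y) == 1).
Proof. by rewrite inE mem_lines card_nontangent trace_neq1; case: ifP. Qed.

Lemma nontangent_linesP (l : {set {set 'cV[F]_3}}) :
  reflect (exists x y, l = perp (row3 1 x y)) (l \in nontangent_lines F).
Proof.
apply: (iffP idP) => [|[x [y ->]]]; last first.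
  by rewrite inE secant_perpE exterior_perpE trace_neq1 orbN.
rewrite !inE -andb_orr => /andP [/imsetP [w]]; rewrite inE => w0 ->.
have [a [b [c ew]]] := row3E w; rewrite {w}ew in w0 *.
have [a0|a0] := eqVneq a 0; last first.
  move=> _; exists (b / a), (c / a).
  rewrite -(perp_scale (row3 1 (b / a) (c / a)) a0); congr perp.
  apply/rowP => j; rewrite !mxE.
  by case: j => [[|[|[|j]]] jP] //=; rewrite ?mulr1 // mulrC divfK.
suff -> : #|perp (row3 a b c) :&: conic F| = 1%N by [].
rewrite card_perp_row3_conic a0; have [b0|b0] := eqVneq b 0.
  rewrite b0 (_ : [set _ | _] = set0) ?cards0 //; apply/setP => s.
  rewrite !inE !mul0r !add0r; apply/negbTE.
  by move: w0; rewrite row3_eq0 a0 b0 eqxx.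
have [g gK _] := injF_bij sqr_inj.
rewrite add0n (_ : [set _ | _] = [set g (c / b)]) ?cards1 //.
have gK' := canF_sym gK.
apply/setP => s; rewrite !inE mul0r add0r addr_eq0 oppx.
rewrite -[RHS](inj_eq sqr_inj) /= gK' -[RHS](inj_eq (mulfI b0)).
by rewrite [b * (c / b)]mulrC divfK.
Qed.

End EvenOrder.

(* Main.v *)
Require Import Defs.
From mathcomp Require Import all_boot all_order all_algebra.
From mathcomp Require Import finfield ring.

Set Implicit Arguments.
Unset Strict Implicit.
Unset Printing Implicit Defensive.

Import GRing.Theory.
Local Open Scope ring_scope.

(** The expression rho_hat vanishes on two distinct non-tangent lines exactly
    when they meet in a point of the conic; this forces both to be secant and
    disposes of exterior lines. The maps (x, y) |-> (x, y + c + x c^2), induced by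
    the translations xi |-> xi + c of the conic, and the swap (x, y) |-> (y, x),
    induced by xi |-> 1/xi, preserve rho_hat, so the common point may be taken to
    be (0, 1, 0). Then the lines are (1, 0, y)^perp and (1, 0, w)^perp, and adding
    the two equations for n = (1, p, q)^perp gives v^2 + v = a + b for
    v = (y + w) p. Each root v <> 0 determines n, while v = 0 forces a = b = 0
    and leaves q free. *)

Section CoordinateCount.
Variable F : finFieldType.
Hypothesis ch2 : 2 \in [pchar F].

Definition rho_coords (l n : F * F) : F :=
  l.1 ^+ 2 * n.2 ^+ 2 + l.2 ^+ 2 * n.1 ^+ 2 + (l.1 + n.1) * (l.2 + n.2).

Definition rho_fiber (a b : F) (l m : F * F) : {set F * F} :=
  [set n | (rho_coords l n == a) && (rho_coords n m == b)].

Definition conic_shift (c : F) (n : F * F) : F * F :=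
  (n.1, n.2 + c + n.1 * c ^+ 2).

Definition swap_coords (n : F * F) : F * F := (n.2, n.1).

(* [ring] works over Z, so an identity of characteristic 2 is proved below by
   adding an explicit multiple of 2. *)
Let two0 : 2 = 0 :> F. Proof. exact: pcharf0 ch2. Qed.

Let addxx (x : F) : x + x = 0. Proof. exact: addrr_pchar2. Qed.

Let add_eq0 (x y : F) : (x + y == 0) = (x == y).
Proof. by rewrite addr_eq0 oppr_pchar2. Qed.

Lemma conic_shiftK c : involutive (conic_shift c).
Proof.
case=> x y; congr (_, _) => /=.
transitivity (y + 2 * (c + x * c ^+ 2)); first by ring.
by rewrite two0 mul0r addr0.
Qed.

Lemma swap_coordsK : involutive swap_coords.
Proof. by case. Qed.

Lemma rho_coords_shift c l n :
  rho_coords (conic_shift c l) (conic_shift c n) = rho_coords l n.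
Proof.
case: l n => [x y] [z u]; rewrite /rho_coords /=.
transitivity (x ^+ 2 * u ^+ 2 + y ^+ 2 * z ^+ 2 + (x + z) * (y + u)
  + 2 * (x ^+ 2 * (u * c + u * z * c ^+ 2 + z * c ^+ 3)
       + z ^+ 2 * (y * c + y * x * c ^+ 2 + x * c ^+ 3)
       + x ^+ 2 * z ^+ 2 * c ^+ 4 + c ^+ 2 * (x ^+ 2 + z ^+ 2)
       + c * (x + z) + x * z * c ^+ 2)); first by ring.
by rewrite two0 mul0r addr0.
Qed.

Lemma rho_coords_swap l n :
  rho_coords (swap_coords l) (swap_coords n) = rho_coords l n.
Proof. by case: l n => [x y] [z u]; rewrite /rho_coords /=; ring. Qed.

Lemma card_rho_fiber_involution f a b l m :
    involutive f -> (forall l n, rho_coords (f l) (f n) = rho_coords l n) ->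
  #|rho_fiber a b (f l) (f m)| = #|rho_fiber a b l m|.
Proof.
move=> fK rho_f; rewrite -[RHS](card_imset _ (inv_inj fK)); apply: eq_card => n.
rewrite -[n in RHS]fK (mem_imset _ _ (inv_inj fK)) !inE.
by rewrite -(rho_f l) -(rho_f _ m) fK.
Qed.

(** Zero is excluded because, in the fibre count, [v = 0] stands for the lines through the shared
    conic point, which are counted separately. *)
Definition artin_schreier_roots (c : F) : {set F} :=
  [set v | (v != 0) && (v ^+ 2 + v == c)].

Lemma artin_schreier_roots0 : artin_schreier_roots 0 = [set 1].
Proof.
apply/setP => v; rewrite !inE add_eq0.
have [->|v0] := eqVneq v 0; first by rewrite [RHS]eq_sym oner_eq0.
by rewrite expr2 -[X in _ == X]mulr1 (inj_eq (mulfI v0)).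
Qed.

(** In characteristic 2, [v ^+ 2 + v + (t ^+ 2 + t)] factors as [(v + t) * (v + (t + 1))], and the
    hypothesis keeps 0 from being a root. *)
Lemma artin_schreier_roots_neq0 t :
  t ^+ 2 + t != 0 -> artin_schreier_roots (t ^+ 2 + t) = [set t; t + 1].
Proof.
move=> c0; apply/setP => v; rewrite !inE.
rewrite -[v == t]add_eq0 -[v == t + 1]add_eq0 -mulf_eq0 -[_ ^+ 2 + v == _]add_eq0.
have -> : (v + t) * (v + (t + 1)) = v ^+ 2 + v + (t ^+ 2 + t).
  transitivity (v ^+ 2 + v + (t ^+ 2 + t) + 2 * (v * t)); first by ring.
  by rewrite two0 mul0r addr0.
have [->|//] := eqVneq v 0.
by rewrite expr0n !add0r (negPf c0).
Qed.

(** The fibre splits by the first coordinate [p] of [n]: the first summand counts [p = 0]; for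
    [p != 0] the map [sol] is a bijection from the roots. *)
Lemma card_rho_fiber0 a b y w : y != w ->
  #|rho_fiber a b (0, y) (0, w)| =
  (((a == 0%R) && (b == 0%R)) * #|F| + #|artin_schreier_roots (a + b)%R|)%N.
Proof.
move=> yw; pose d := y + w.
have d0 : d != 0 by rewrite /d add_eq0.
(* With [p = v / d], the second coordinate is the solution [q] of
   [y ^+ 2 * p ^+ 2 + p * (y + q) = a]. *)
pose sol v : F * F := (v / d, a * d / v + y ^+ 2 * (v / d) + y).
have solI : injective sol by move=> u v [/(mulIf (invr_neq0 d0))].
have rho0l p q : rho_coords (0, y) (p, q) = y ^+ 2 * p ^+ 2 + p * (y + q).
  by rewrite /rho_coords /=; ring.
have rho0r p q : rho_coords (p, q) (0, w) = w ^+ 2 * p ^+ 2 + p * (w + q).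
  by rewrite /rho_coords /=; ring.
pose S := rho_fiber a b (0, y) (0, w).
pose V := [set n : F * F | n.1 == 0].
rewrite -/S -(cardsID V S); congr (_ + _)%N.
  have SV : S :&: V =
      if (a == 0) && (b == 0) then [set (0, q) | q : F] else set0.
    apply/setP => -[p q]; rewrite !inE /= rho0l rho0r.
    have [->|p0] /= := eqVneq p 0; last first.
      rewrite andbF; case: ifP => _; rewrite ?inE //.
      by apply/esym/imsetP => -[r _ [p0']]; rewrite p0' eqxx in p0.
    rewrite expr0n !mulr0 !mul0r !addr0 andbT ![0 == _]eq_sym.
    case: ifP => _; last by rewrite inE.
    by apply/esym/imsetP; exists q.
  rewrite SV; case: ifP => _; last by rewrite cards0.
  by rewrite card_imset ?mul1n // => q r [].
rewrite -(card_imset _ solI); apply: eq_card => -[p q].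
rewrite !inE /= rho0l rho0r; apply/and3P/imsetP => [[p0 /eqP ea /eqP eb]|].
  exists (d * p).
    rewrite inE mulf_neq0 //= -ea -eb -add_eq0 /d.
    apply/eqP; transitivity (2 * (y * w * p ^+ 2 + y ^+ 2 * p ^+ 2
      + w ^+ 2 * p ^+ 2 + y * p + w * p + p * q)); first by ring.
    by rewrite two0 mul0r.
  rewrite /sol [d * p]mulrC mulfK //; congr (_, _).
  rewrite -ea.
  transitivity (q + 2 * (y + y ^+ 2 * p)); first by rewrite two0 mul0r addr0.
  by field; apply/andP.
case=> v; rewrite inE => /andP [v0 /eqP ev] [-> ->].
have p0 : v / d != 0 by rewrite mulf_neq0 ?invr_eq0.
have ea : y ^+ 2 * (v / d) ^+ 2 + v / d * (y + (a * d / v + y ^+ 2 * (v / d) + y)) = a.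
  transitivity (a + 2 * (v / d * y + y ^+ 2 * (v / d) ^+ 2)).
    by field; apply/andP.
  by rewrite two0 mul0r addr0.
split=> //; first by rewrite ea.
(* Substituting for [b], then for [a] by the first equation with [q] generalized to [s], turns the
   second equation into a polynomial identity. *)
have -> : b = v ^+ 2 + v + a by rewrite ev addrAC addxx add0r.
move: ea; set s := _ + y; move: s => s <-; rewrite -add_eq0.
have {3 4}-> : v = d * (v / d) by rewrite mulrC divfK.
move: (v / d) => r; rewrite /d; apply/eqP.
transitivity (2 * (y * w * r ^+ 2 + y ^+ 2 * r ^+ 2 + w ^+ 2 * r ^+ 2
   + y * r + w * r + r * s)); first by ring.
by rewrite two0 mul0r.
Qed.

(* The conic point shared by the lines [l] and [m] is (0, 1, 0) in the first
   case and (xi, xi^2, 1) in the second. *)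
Lemma rho_coords_eq0 l m : rho_coords l m = 0 -> l != m ->
  (l.1 = 0 /\ m.1 = 0) \/
  exists xi, (conic_shift xi l).2 = 0 /\ (conic_shift xi m).2 = 0.
Proof.
case: l m => [x y] [z w]; rewrite /rho_coords /= => r0 lm.
have [xz|xz] := eqVneq x z.
  left; subst z; move: lm; rewrite xpair_eqE eqxx /= => yw.
  suff /eqP -> : x == 0 by [].
  (* For [x = z], [rho_coords] reduces to this square. *)
  have : (x * (y + w)) ^+ 2 == 0.
    rewrite -r0; apply/eqP; transitivity (x ^+ 2 * w ^+ 2 + y ^+ 2 * x ^+ 2
      + (x + x) * (y + w) + 2 * (x ^+ 2 * y * w - x * (y + w))); first by ring.
    by rewrite two0 mul0r addr0.
  by rewrite expf_eq0 mulf_eq0 add_eq0 (negPf yw) orbF.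
right; have s0 : x + z != 0 by rewrite add_eq0.
(* The lines meet in their cross product [(D, y + w, x + z)], and [D2] says that this point lies on
   the conic [X ^+ 2 = Y * Z]; scaling its last coordinate to 1 gives [xi]. *)
pose D := x * w + y * z.
have D2 : D ^+ 2 = (x + z) * (y + w).
  apply/eqP; rewrite -add_eq0 -r0; apply/eqP.
  transitivity (x ^+ 2 * w ^+ 2 + y ^+ 2 * z ^+ 2 + (x + z) * (y + w)
    + 2 * (x * w * y * z)); first by rewrite /D; ring.
  by rewrite two0 mul0r addr0.
exists (D / (x + z)).
have -> : (D / (x + z)) ^+ 2 = (y + w) / (x + z).
  by rewrite expr_div_n D2; field.
split.
  transitivity (2 * (x * (y + w) + y * z) / (x + z)); last by rewrite two0 !mul0r.
  by rewrite /D; field.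
transitivity (2 * (z * (y + w) + x * w) / (x + z)); last by rewrite two0 !mul0r.
by rewrite /D; field.
Qed.

Lemma card_rho_fiber a b l m : rho_coords l m = 0 -> l != m ->
  #|rho_fiber a b l m| =
  (((a == 0%R) && (b == 0%R)) * #|F| + #|artin_schreier_roots (a + b)%R|)%N.
Proof.
move=> r0 lm; case: (rho_coords_eq0 r0 lm) => [|[xi]].
  case: l m lm {r0} => [x y] [z w] /= lm [x0 z0]; move: lm; rewrite x0 z0.
  by rewrite xpair_eqE eqxx; apply: card_rho_fiber0.
rewrite -(card_rho_fiber_involution a b l m (conic_shiftK xi) (rho_coords_shift xi)).
rewrite -(inj_eq (inv_inj (conic_shiftK xi))) in lm.
case: (conic_shift xi l) (conic_shift xi m) lm => [x y] [z w] /= lm [y0 w0].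
move: lm; rewrite y0 w0 xpair_eqE eqxx andbT.
(* After the shift both lines pass through (0, 0, 1), which the swap sends to (0, 1, 0). *)
rewrite -(card_rho_fiber_involution a b _ _ swap_coordsK rho_coords_swap).
exact: card_rho_fiber0.
Qed.

End CoordinateCount.

Lemma rho_hat_perp (F : finFieldType) (p q : F * F) :
  rho_hat (perp (row3 1 p.1 p.2)) (perp (row3 1 q.1 q.2)) = rho_coords p q.
Proof. by rewrite /rho_hat !nt_coordsK. Qed.

Lemma abs_trace_rho_coords_eq0 (F : finFieldType) (k : nat) (l m : F * F) :
    #|F| = (2 ^ k)%N -> rho_coords l m = 0 -> l != m ->
  abs_trace (l.1 * l.2) = 0.
Proof.
move=> Fk r0 lm; have ch2 := card_finPcharP Fk (isT : prime 2).
apply/(abs_trace_eq0 Fk).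
case: (rho_coords_eq0 ch2 r0 lm) => [[-> _]|[xi [/= e _]]].
  by exists 0; rewrite mul0r expr0n !addr0.
(* This is the incidence relation [l.2 + xi + l.1 * xi ^+ 2 = 0] multiplied by [l.1]. *)
exists (l.1 * xi).
transitivity (l.1 * (l.2 + xi + l.1 * xi ^+ 2)); first by ring.
by rewrite e mulr0.
Qed.

Lemma card_rho_hat_fiber (F : finFieldType) (k : nat) (a b : F) (l m : F * F) :
    #|F| = (2 ^ k)%N ->
  #|[set n in nontangent_lines F | (rho_hat (perp (row3 1 l.1 l.2)) n == a)
      && (rho_hat n (perp (row3 1 m.1 m.2)) == b)]| = #|rho_fiber a b l m|.
Proof.
move=> Fk; pose f (n : F * F) := perp (row3 1 n.1 n.2).
have fI : injective f by move=> [x y] [z u] /perp_row3_inj.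
rewrite -(card_imset _ fI); apply: eq_card => n; rewrite inE.
apply/andP/imsetP => [[/(nontangent_linesP Fk) [x [y ->]]]|[p + ->]].
  by rewrite !(rho_hat_perp _ (x, y), rho_hat_perp (x, y)) => h; exists (x, y); rewrite ?inE.
rewrite inE !rho_hat_perp => h; split=> //.
by apply/(nontangent_linesP Fk); exists p.1, p.2.
Qed.

Theorem mainTheorem15 (F : finFieldType) (k : nat) (a b : F)
    (l m : {set {set 'cV[F]_3}}) (N : nat) :
  #|F| = (2 ^ k)%N ->
  l \in nontangent_lines F -> m \in nontangent_lines F -> l != m ->
  rho_hat l m = 0 ->
  N = #|[set n in nontangent_lines F | (rho_hat l n == a) && (rho_hat n m == b)]| ->
  (l \in exterior_lines F -> N = 0%N) /\
  (l \in secant_lines F ->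
     [/\ a = 0 /\ b = 0 -> N = #|F|.+1,
         a = b /\ a != 0 -> N = 1%N
       & a + b \in T0star F -> N = 2%N]).
Proof.
move=> Fk /(nontangent_linesP Fk) [x [y ->]] /(nontangent_linesP Fk) [z [w ->]].
have ch2 := card_finPcharP Fk (isT : prime 2).
move=> lm; rewrite (rho_hat_perp (x, y) (z, w)) => r0.
have {}lm : (x, y) != (z, w) by apply: contraNneq lm => -[-> ->].
rewrite (card_rho_hat_fiber a b (x, y) (z, w) Fk) (card_rho_fiber ch2 a b r0 lm) => ->.
split.
  rewrite (exterior_perpE Fk) (abs_trace_rho_coords_eq0 Fk r0 lm).
  by rewrite eq_sym oner_eq0.
move=> _; split=> [[-> ->]|[<- a0]|].
- by rewrite eqxx addr0 artin_schreier_roots0 // cards1 mul1n addn1.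
- by rewrite (negPf a0) addrr_pchar2 // artin_schreier_roots0 // cards1.
(* Trace zero supplies [t] with [t ^+ 2 + t = a + b], and [a + b != 0] excludes [a = b = 0], so only
   the roots [t] and [t + 1] count. *)
rewrite !inE => /andP [ab0 /eqP/(abs_trace_eq0 Fk) [t /eqP]].
rewrite addr_eq0 oppr_pchar2 // => /eqP e; rewrite -e in ab0 *.
rewrite artin_schreier_roots_neq0 // cards2.
have -> : t != t + 1 by rewrite -subr_eq0 opprD addNKr oppr_eq0 oner_eq0.
suff /negPf -> : ~~ ((a == 0) && (b == 0)) by [].
by apply: contraNN ab0 => /andP [/eqP a0 /eqP b0]; rewrite e a0 b0 addr0.
Qed.
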